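(* For any compact positive definite metric space $A$, $$|A| = \sup \left\{ \frac{\mu(A)^2}{Z_A(\mu,\mu)} : \mu \in FM(A),\ \mu \neq 0 \right\} = \sup \bigl\{ |B| : B \subseteq A \text{ is finite and nonempty} \bigr\}$$ and $$|A|_+ = \sup \left\{ \frac{\mu(A)^2}{Z_A(\mu,\mu)} : \mu \in FM_+(A),\ \mu \neq 0 \right\} = \sup \bigl\{ |B|_+ : B \subseteq A \text{ is finite and nonempty} \bigr\}.$$
   Context: Metric spaces are nonempty. For a finite metric space $(B,d)$, its similarity matrix is $\zeta_B \in \mathbb{R}^{B\times B}$, $\zeta_B(x,y)=e^{-d(x,y)}$; a metric space $A$ is positive definite if $\zeta_B$ is a positive definite matrix for every nonempty finite subset $B \subseteq A$ (with the induced metric). $M(A)$ is the space of finite signed Borel measures on $A$, $M_+(A)$ the cone of positive (nonnegative) measures in $M(A)$, $FM(A)$ the space of finitely supported signed measures, and $FM_+(A)$ the cone of finitely supported positive measures. For compact $(A,d)$, $Z_A(\mu,\nu) = \int_A\int_A e^{-d(x,y)}\,d\mu(x)\,d\nu(y)$ for $\mu,\nu\in M(A)$. For a compact positive definite metric space $A$, the magnitude is $|A| = \sup\{\mu(A)^2/Z_A(\mu,\mu) : \mu\in M(A),\ Z_A(\mu,\mu)\neq 0\} \in [1,\infty]$ and the maximum diversity is $|A|_+ = \sup\{\mu(A)^2/Z_A(\mu,\mu) : \mu\in M_+(A),\ \mu\neq 0\}$. (For finite positive definite $B$, $|B|$ agrees with the original definition of magnitude of a finite space, $|B| = \sum_{x\in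 B} w(x)$, where $w\in\mathbb{R}^B$ is the vector with $\sum_{y\in B} e^{-d(x,y)}w(y)=1$ for all $x\in B$.) *)

(* Defs.v *)
From HB Require Import structures.
From mathcomp Require Import all_boot all_order all_algebra finmap.
From mathcomp Require Import all_classical all_reals all_analysis.

Set Implicit Arguments.
Unset Strict Implicit.
Unset Printing Implicit Defensive.

Import Order.TTheory GRing.Theory Num.Theory.
Import numFieldNormedType.Exports.

Local Open Scope classical_set_scope.
Local Open Scope ring_scope.

(* Metric spaces are nonempty. This is rendered by a distinguished point, which
   measurableType requires and which plays no other role. *)
#[short(type="pmetricType")]
HB.structure Definition PMetric (R : numDomainType) :=
  { M of Metric R M & Pointed M }.

Definition similarity (R : realType) (A : metricType R) (x y : A) : R :=
  expR (- mdist x y).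

(* A matrix in R^{I x I} is a function of two indices, so that similarity
   matrices are indexed by the points themselves. *)
Definition posdefmx (R : realType) (I : finType) (M : I -> I -> R) : Prop :=
  (forall i j, M i j = M j i) /\
  (forall v : I -> R, (exists i, v i != 0) ->
    0 < \sum_(i : I) \sum_(j : I) v i * M i j * v j).

Definition positive_definite (R : realType) (A : metricType R) : Prop :=
  forall B : {fset A}, B != fset0 ->
    posdefmx (fun x y : B => similarity (val x) (val y)).

Definition borel (R : realType) (A : pmetricType R) :=
  g_sigma_algebraType (@open A).

(* Charges are finite on measurable sets, so this is M(A). The values of a
   charge on non-measurable sets are unconstrained: every condition on a
   charge below only involves measurable sets. *)
Definition signed_measure (R : realType) (A : pmetricType R) :=
  {charge set (borel A) -> \bar R}.

Definition nonzero (R : realType) (A : pmetricType R)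
    (mu : signed_measure A) : Prop :=
  exists2 E : set (borel A), measurable E & mu E != 0%E.

Definition positive_measure (R : realType) (A : pmetricType R)
    (mu : signed_measure A) : Prop :=
  forall E : set (borel A), measurable E -> (0 <= mu E)%E.

Definition finitely_supported (R : realType) (A : pmetricType R)
    (mu : signed_measure A) : Prop :=
  exists2 F : set (borel A), finite_set F &
    forall E : set (borel A), measurable E -> E `&` F = set0 -> mu E = 0%E.

(* Integral against a signed measure: the difference of the integrals against
   its Jordan components, which are essentially independent of the chosen Hahn
   decomposition (Hahn_decomposition_uniq). *)
Definition charge_integral d (T : measurableType d) (R : realType)
    (nu : {charge set T -> \bar R}) (f : T -> R) : R :=
  let nuPN := projT2 (cid (projT2 (cid (Hahn_decomposition nu)))) in
  (\int[jordan_pos nuPN]_x f x) - (\int[jordan_neg nuPN]_x f x).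

Definition Zform (R : realType) (A : pmetricType R)
    (mu nu : signed_measure A) : R :=
  charge_integral nu (fun y : borel A =>
    charge_integral mu (fun x : borel A => similarity (x : A) (y : A))).

Definition mass_ratio (R : realType) (A : pmetricType R)
    (mu : signed_measure A) : R :=
  fine (mu [set: borel A]) ^+ 2 / Zform mu mu.

Definition magnitude (R : realType) (A : pmetricType R) : \bar R :=
  ereal_sup [set (mass_ratio mu)%:E
            | mu in [set mu : signed_measure A | Zform mu mu != 0]].

Definition maximum_diversity (R : realType) (A : pmetricType R) : \bar R :=
  ereal_sup [set (mass_ratio mu)%:E
            | mu in [set mu : signed_measure A |
                      positive_measure mu /\ nonzero mu]].

(* A nonempty finite subset as a metric space in its own right, with the
   induced metric. *)
Definition fsubspace (R : realType) (A : metricType R) (B : {fset A})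
  (B0 : B != fset0) : Type := fset_sub_type B.

Section fsubspace_metric.
Context (R : realType) (A : metricType R) (B : {fset A}) (B0 : B != fset0).

HB.instance Definition _ := Finite.copy (fsubspace B0) (fset_sub_type B).

Let fsubspace_point : fsubspace B0 := [` xchooseP (fset0Pn B B0)]%fset.

HB.instance Definition _ := isPointed.Build (fsubspace B0) fsubspace_point.

Let fsubspace_dist (x y : fsubspace B0) : R := mdist (fsval x) (fsval y).

Let fsubspace_distxx x : fsubspace_dist x x = 0.
Proof. exact: mdistxx. Qed.

Let fsubspace_dist_positivity x y : fsubspace_dist x y = 0 -> x = y.
Proof. by move/mdist_positivity/val_inj. Qed.

Let fsubspace_dist_sym x y : fsubspace_dist x y = fsubspace_dist y x.
Proof. exact: metric_sym. Qed.

Let fsubspace_dist_triangle y x z :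
  fsubspace_dist x z <= fsubspace_dist x y + fsubspace_dist y z.
Proof. exact: metric_triangle. Qed.

HB.instance Definition _ := isMetric.Build R (fsubspace B0)
  fsubspace_distxx fsubspace_dist_positivity fsubspace_dist_sym
  fsubspace_dist_triangle.

End fsubspace_metric.

(* Main.v *)
Require Import Defs.
From mathcomp Require Import all_boot all_order all_algebra finmap.
From mathcomp Require Import all_classical all_reals all_analysis.
From mathcomp Require Import measurable_realfun lra.

(** Charges can be pushed forward along Borel maps, and both equalities come
    from watching what this does to the ratio of mu(A)^2 by Z(mu, mu).

    Pushing forward keeps the total mass and positivity. If nu is the image of
    mu under phi, change of variables turns Z(nu, nu) into the double integral
    of exp(- d(phi x, phi y)) against mu [Zform_pushforward]. Hence Z is kept
    when phi is isometric [Zform_isometry], and moves by at most a constant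
    depending on mu alone times e when phi changes distances by at most e
    [Zform_pushforward_near], because t |-> exp(- t) is 1-Lipschitz on
    nonnegative reals.

    - The inclusion of a finite subset B in A is isometric, so every charge on B
      has an image on A that is finitely supported and has the same ratio
      [extend_fsubspace_charge].
    - By compactness A has arbitrarily fine finite nets B, and sending a point
      to the first point of B close to it is a Borel map that changes distances
      little [compact_finite_net]. So if Z(mu, mu) is nonzero, then, the ratio
      being continuous in Z there, some charge on a finite B has a ratio at
      least that of mu up to any given error [approx_by_fsubspace_charge].

    Therefore |A| <= sup |B| <= sup over FM(A) <= |A|, and the same cycle holds
    for positive charges. The charges with Z(mu, mu) = 0 cannot disturb it:
    division by zero gives them ratio 0, below the ratio 1 of a point mass
    [point_mass].

    Change of variables for charges is not immediate, as the image of a Jordan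
    decomposition of mu need not be a Jordan decomposition of the image of mu.
    It follows from the fact that the integral of a bounded function can be
    computed from any way of writing the charge as a difference of two finite
    measures [charge_integral_difference]. *)

Set Implicit Arguments.
Unset Strict Implicit.
Unset Printing Implicit Defensive.

Import Order.TTheory GRing.Theory Num.Theory.
Import numFieldNormedType.Exports.

Local Open Scope classical_set_scope.
Local Open Scope ring_scope.

(** * Integration against charges *)

Definition bounded_measurable d (T : measurableType d) (R : realType)
    (f : T -> R) : Prop :=
  measurable_fun [set: T] f /\ exists M, forall x, `|f x| <= M.

Section charge_integral.
Context d (T : measurableType d) (R : realType).
Implicit Types (P N : {measure set T -> \bar R}).
Implicit Types (nu : {charge set T -> \bar R}) (f g : T -> R).

Lemma bounded_measurableB f g : bounded_measurable f -> bounded_measurable g ->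
  bounded_measurable (fun x => f x - g x).
Proof.
move=> [mf [M fM]] [mg [L gL]]; split; first exact: measurable_funB.
by exists (M + L) => x; rewrite (le_trans (ler_normB _ _))// lerD.
Qed.

Lemma bounded_measurable_comp d' (T' : measurableType d') (phi : T' -> T) f :
  measurable_fun [set: T'] phi -> bounded_measurable f ->
  bounded_measurable (f \o phi).
Proof.
move=> mphi [mf [M fM]]; split; first exact: measurableT_comp.
by exists M => x; exact: fM.
Qed.

Lemma bounded_measurable_integrable P f : fin_num_fun P ->
  bounded_measurable f -> P.-integrable [set: T] (EFin \o f).
Proof.
move=> Pfin [mf [M fM]]; apply: measurable_bounded_integrable => //.
  by rewrite -ge0_fin_numE// Pfin.
exists M; split; first exact: num_real.
by move=> y My x _; rewrite /= (le_trans (fM x))// ltW.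
Qed.

(** This hides the Hahn decomposition chosen in the definition of
    [charge_integral]: later proofs only see a pair of finite measures. *)
Lemma charge_integral_jordan nu : exists P N,
  [/\ fin_num_fun P, fin_num_fun N,
      forall E, measurable E -> (nu E = P E - N E)%E
    & forall f, charge_integral nu f = \int[P]_x f x - \int[N]_x f x].
Proof.
pose nuPN := projT2 (cid (projT2 (cid (Hahn_decomposition nu)))).
exists (jordan_pos nuPN), (jordan_neg nuPN); split => //.
by move=> E mE; rewrite (jordan_decomp nuPN mE) /cadd /= cscaleN1.
Qed.

Lemma Rintegral_measure_add P N f : fin_num_fun P -> fin_num_fun N ->
  bounded_measurable f ->
  \int[measure_add P N]_x f x = \int[P]_x f x + \int[N]_x f x.
Proof.
move=> Pfin Nfin bmf.
have iP := bounded_measurable_integrable Pfin bmf.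
have iN := bounded_measurable_integrable Nfin bmf.
rewrite /Rintegral integral_measure_add//.
by rewrite fineD//; exact: integrable_fin_num.
Qed.

(** If P - N and P' - N' are the same charge, then P + N' and P' + N are the
    same measure, so f has the same integral against both. *)
Lemma charge_integral_difference nu P N f :
    fin_num_fun P -> fin_num_fun N ->
    (forall E, measurable E -> (nu E = P E - N E)%E) -> bounded_measurable f ->
  charge_integral nu f = \int[P]_x f x - \int[N]_x f x.
Proof.
move=> Pfin Nfin nuE bmf.
have [P' [N' [P'fin N'fin nuE' ->]]] := charge_integral_jordan nu.
apply/eqP; rewrite subr_eq addrAC eq_sym subr_eq; apply/eqP.
rewrite -!Rintegral_measure_add//; congr fine.
apply: eq_measure_integral => E mE _.
apply: (etrans (measure_addE _ _ _)); apply/esym/(etrans (measure_addE _ _ _)).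
have := nuE' _ mE; rewrite (nuE _ mE).
move: (Pfin E mE) (Nfin E mE) (P'fin E mE) (N'fin E mE).
case: (P E) (N E) (P' E) (N' E) => [p||] [n||] [p'||] [n'||]//= _ _ _ _.
by rewrite -!EFinD => -[pn]; congr EFin; lra.
Qed.

Lemma charge_integral0 nu f : (forall E, measurable E -> nu E = 0%E) ->
  bounded_measurable f -> charge_integral nu f = 0.
Proof.
move=> nu0 bmf; rewrite (@charge_integral_difference _ mzero mzero)//.
  by rewrite subrr.
by move=> E mE; rewrite nu0// /mzero sube0.
Qed.

Lemma charge_integral_dirac nu a f :
    (forall E, measurable E -> nu E = \d_a E) ->
  bounded_measurable f -> charge_integral nu f = f a.
Proof.
move=> nua bmf; rewrite (@charge_integral_difference _ \d_a mzero)//; last first.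
  by move=> E mE; rewrite nua// /mzero sube0.
rewrite /Rintegral integral_dirac//; last by apply/measurable_EFinP; case: bmf.
by rewrite integral_measure_zero subr0 diracT mul1e.
Qed.

Lemma charge_integralB nu f g : bounded_measurable f -> bounded_measurable g ->
  charge_integral nu (fun x => f x - g x) =
  charge_integral nu f - charge_integral nu g.
Proof.
move=> bmf bmg.
have [P [N [Pfin Nfin _ nuE]]] := charge_integral_jordan nu.
by rewrite !nuE !RintegralB//; [lra|exact: bounded_measurable_integrable..].
Qed.

(** The constant c is the total variation of nu. *)
Lemma charge_integral_bound nu : exists2 c, 0 <= c & forall f e,
  bounded_measurable f -> (forall x, `|f x| <= e) ->
  `|charge_integral nu f| <= c * e.
Proof.
have [P [N [Pfin Nfin _ nuE]]] := charge_integral_jordan nu.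
exists (fine (P setT) + fine (N setT)); first by rewrite addr_ge0// fine_ge0.
move=> f e bmf fe; rewrite nuE (le_trans (ler_normB _ _))//.
have Q (Q : {measure set T -> \bar R}) : fin_num_fun Q ->
    `|\int[Q]_x f x| <= fine (Q setT) * e.
  move=> Qfin; have iQ := bounded_measurable_integrable Qfin bmf.
  rewrite (le_trans (le_normr_Rintegral _ _))// mulrC -Rintegral_cst//.
  apply: le_Rintegral => //.
  - exact: integrable_norm.
  - apply: bounded_measurable_integrable => //; split => //.
    by exists `|e|.
by rewrite mulrDl lerD ?Q.
Qed.

End charge_integral.

(** The images of the two measures of a decomposition of nu form a decomposition
    of nu', which need not be mutually singular. *)
Lemma charge_integral_pushforward d d' (T : measurableType d)
    (T' : measurableType d') (R : realType) (phi : T -> T')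
    (nu : {charge set T -> \bar R}) (nu' : {charge set T' -> \bar R})
    (f : T' -> R) :
  measurable_fun [set: T] phi ->
  (forall E, nu' E = nu (phi @^-1` E)) -> bounded_measurable f ->
  charge_integral nu' f = charge_integral nu (f \o phi).
Proof.
move=> mphi nu'E bmf.
have [P [N [Pfin Nfin nuE ->]]] := charge_integral_jordan nu.
have mpre E : measurable E -> measurable (phi @^-1` E).
  by move=> mE; rewrite -[X in measurable X]setTI; exact: mphi.
rewrite (@charge_integral_difference _ _ _ _ (pushforward P phi)
  (pushforward N phi))//.
- have push (Q : {measure set T -> \bar R}) : fin_num_fun Q ->
      \int[pushforward Q phi]_x f x = \int[Q]_x (f \o phi) x.
    move=> Qfin; rewrite /Rintegral integral_pushforward//.
    + by apply/measurable_EFinP; case: bmf.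
    + apply: (bounded_measurable_integrable Qfin).
      exact: bounded_measurable_comp.
  by rewrite !push.
- by move=> E mE; apply: Pfin; exact: mpre.
- by move=> E mE; apply: Nfin; exact: mpre.
- by move=> E mE; rewrite nu'E nuE//; exact: mpre.
Qed.

(** Images are handled through their values, because the measurability of phi
    cannot be recovered from the set function [pushforward nu phi]. *)
Lemma exists_pushforward d d' (T : measurableType d) (T' : measurableType d')
    (R : realType) (phi : T -> T') (nu : {charge set T -> \bar R}) :
  measurable_fun [set: T] phi ->
  exists nu' : {charge set T' -> \bar R}, forall E, nu' E = nu (phi @^-1` E).
Proof. by move=> mphi; unshelve eexists (pushforward nu phi). Qed.

(** * The similarity kernel *)

Section similarity.
Context (R : realType).

(** For s <= t the difference is exp(-s) (1 - exp(-(t - s))), where the first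
    factor is at most 1 and the second at most t - s. *)
Lemma expRN_lipschitz (s t : R) : 0 <= s -> 0 <= t ->
  `|expR (- s) - expR (- t)| <= `|s - t|.
Proof.
wlog st : s t / s <= t.
  move=> H s0 t0; have [st|/ltW ts] := leP s t; first exact: H.
  by rewrite distrC (distrC s); exact: H.
move=> s0 t0; rewrite ger0_norm; last by rewrite subr_ge0 ler_expR lerN2.
rewrite distrC ger0_norm ?subr_ge0//.
have -> : - t = - s + - (t - s) by lra.
rewrite expRD -{1}[expR (- s)]mulr1 -mulrBr.
have := expR_ge1Dx (- (t - s)); have := expR_gt0 (- s).
have : expR (- s) <= 1 by rewrite -expR0 ler_expR oppr_le0.
have : expR (- (t - s)) <= 1 by rewrite -expR0 ler_expR oppr_le0 subr_ge0.
set a := expR (- s); set b := expR _ => b1 a1 a0 tb.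
rewrite (le_trans (_ : _ <= 1 * (1 - b))) //; last lra.
by rewrite ler_wpM2r// subr_ge0.
Qed.

Lemma similarity_ge0 (A : metricType R) (x y : A) : 0 <= similarity x y.
Proof. exact: expR_ge0. Qed.

Lemma similarity_le1 (A : metricType R) (x y : A) : similarity x y <= 1.
Proof. by rewrite -expR0 ler_expR oppr_le0 mdist_ge0. Qed.

Lemma similarity_lipschitz (A : metricType R) (x y x' y' : A) :
  `|similarity x y - similarity x' y'| <= mdist x x' + mdist y y'.
Proof.
apply: (le_trans (expRN_lipschitz (mdist_ge0 _ _) (mdist_ge0 _ _))).
rewrite ler_norml; apply/andP; split.
- have := metric_triangle x' x y'; have := metric_triangle x y y'.
  by rewrite (metric_sym x' x); lra.
- have := metric_triangle x x' y; have := metric_triangle x' y' y.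
  by rewrite (metric_sym y' y); lra.
Qed.

End similarity.

(** * Borel measurability of continuous maps *)

Section borel.
Context (R : realType).

Lemma continuous_borel_measurable (A B : pmetricType R) (phi : A -> B) :
  continuous phi -> measurable_fun [set: borel A] (phi : borel A -> borel B).
Proof.
move=> /continuousP cphi.
apply: (@measurability _ _ (borel A) (borel B) setT phi (@open B)) => //.
by move=> _ [U oU <-]; rewrite setTI; apply: sub_sigma_algebra; exact: cphi.
Qed.

Lemma mdist_lipschitz_continuous (A : metricType R) (B : metricType R)
    (f : A -> B) c :
  (forall x y, mdist (f x) (f y) <= c * mdist x y) -> continuous f.
Proof.
move=> fc x; apply/cvg_ballP => e e0.
(* c may be zero or negative, so the radius is divided by `|c| + 1. *)
have c0 : 0 < `|c| + 1 by rewrite ltr_wpDl.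
apply/nbhs_ballP; exists (e / (`|c| + 1)); first exact: divr_gt0.
move=> y; rewrite !ballEmdist /= ltr_pdivlMr// => xy.
rewrite (le_lt_trans (fc x y))// (le_lt_trans _ xy)// mulrC ler_wpM2l//.
  exact: mdist_ge0.
by rewrite (le_trans (ler_norm c))// lerDl.
Qed.

Lemma lipschitz_borel_measurable (A : pmetricType R) (f : A -> R) c :
  (forall x y, `|f x - f y| <= c * mdist x y) ->
  measurable_fun [set: borel A] (f : borel A -> R).
Proof.
move=> fc; have /continuousP cf : continuous (f : A -> R^o).
  (* The distance of R^o is `|y - x|, whose topology is that of R. *)
  apply: (@mdist_lipschitz_continuous A R^o f c) => x y.
  by rewrite /mdist/= distrC.
apply: (measurability _ (RGenOpens.measurableE R)).
move=> _ [_ [a [b ->] <-]]; rewrite setTI; apply: sub_sigma_algebra.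
exact/cf/interval_open.
Qed.

End borel.

(** * The form Z and images of charges *)

Section Zform.
Context (R : realType).

Lemma similarity_bounded_measurable (A : pmetricType R) (y : A) :
  bounded_measurable (fun x : borel A => similarity (x : A) y).
Proof.
split.
  apply: (@lipschitz_borel_measurable _ _ _ 1) => x x'.
  by rewrite (le_trans (similarity_lipschitz _ _ _ _))// mdistxx addr0 mul1r.
by exists 1 => x; rewrite ger0_norm ?similarity_le1// similarity_ge0.
Qed.

(** The potential of mu inherits from the kernel a Lipschitz constant and a
    bound, both equal to the total variation of mu. This makes the outer
    integral of [Zform] meaningful without product measures. *)
Lemma potential_bounded_measurable (A : pmetricType R) (mu : signed_measure A) :
  bounded_measurable (fun y : borel A =>
    charge_integral mu (fun x : borel A => similarity (x : A) (y : A))).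
Proof.
have [c c0 muc] := charge_integral_bound mu; split.
  apply: (@lipschitz_borel_measurable _ _ _ c) => y y'.
  rewrite -charge_integralB; [|exact: similarity_bounded_measurable..].
  apply: muc => [|x].
    by apply: bounded_measurableB; exact: similarity_bounded_measurable.
  by rewrite (le_trans (similarity_lipschitz _ _ _ _))// mdistxx add0r.
exists (c * 1) => y; apply: (muc); first exact: similarity_bounded_measurable.
by move=> x; rewrite ger0_norm ?similarity_le1// similarity_ge0.
Qed.

Section pushforward.
Context (A B : pmetricType R) (phi : A -> B).
Context (mphi : measurable_fun [set: borel A] (phi : borel A -> borel B)).
Context (mu : signed_measure A) (nu : signed_measure B).
Context (nuE : forall E, nu E = mu (phi @^-1` E)).

Lemma potential_pushforward (y : B) :
  charge_integral nu (fun x : borel B => similarity (x : B) y) =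
  charge_integral mu (fun x : borel A => similarity (phi x) y).
Proof.
apply: (charge_integral_pushforward mphi nuE).
exact: similarity_bounded_measurable.
Qed.

Lemma Zform_pushforward : Zform nu nu =
  charge_integral mu (fun y : borel A =>
    charge_integral mu (fun x : borel A => similarity (phi x) (phi y))).
Proof.
rewrite /Zform (charge_integral_pushforward mphi nuE).
  by congr charge_integral; apply/funext => y /=; exact: potential_pushforward.
exact: potential_bounded_measurable.
Qed.

Lemma Zform_isometry :
  (forall x y, mdist (phi x) (phi y) = mdist x y) -> Zform nu nu = Zform mu mu.
Proof.
move=> iso; rewrite Zform_pushforward /Zform.
congr charge_integral; apply/funext => y.
by congr charge_integral; apply/funext => x; rewrite /similarity iso.
Qed.

End pushforward.

(** The constant is the square of the total variation of mu, one factor for each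
    integral. It does not depend on the target space B, which varies with the
    net in the approximation argument. *)
Lemma Zform_pushforward_near (A : pmetricType R) (mu : signed_measure A) :
  exists2 c, 0 <= c & forall (B : pmetricType R) (phi : A -> B)
    (nu : signed_measure B) e,
  measurable_fun [set: borel A] (phi : borel A -> borel B) ->
  (forall E, nu E = mu (phi @^-1` E)) ->
  (forall x y, `|mdist (phi x) (phi y) - mdist x y| <= e) ->
  `|Zform nu nu - Zform mu mu| <= c * e.
Proof.
have [c c0 muc] := charge_integral_bound mu.
exists (c * c); first exact: mulr_ge0.
move=> B phi nu e mphi nuE phie.
have bphi y : bounded_measurable (fun x : borel A => similarity (phi x) (phi y)).
  exact: (bounded_measurable_comp mphi (similarity_bounded_measurable (phi y))).
have bpot : bounded_measurable (fun y : borel A =>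
    charge_integral mu (fun x : borel A => similarity (phi x) (phi y))).
  have := bounded_measurable_comp mphi (potential_bounded_measurable nu).
  congr bounded_measurable; apply/funext => y.
  exact: potential_pushforward.
rewrite (Zform_pushforward mphi nuE) /Zform -charge_integralB//; last first.
  exact: potential_bounded_measurable.
rewrite -mulrA; apply: (muc) => [|y].
  by apply: bounded_measurableB => //; exact: potential_bounded_measurable.
rewrite -charge_integralB//; last exact: similarity_bounded_measurable.
apply: muc => [|x].
  by apply: bounded_measurableB => //; exact: similarity_bounded_measurable.
by rewrite (le_trans (expRN_lipschitz (mdist_ge0 _ _) (mdist_ge0 _ _))).
Qed.

Lemma Zform_neq0_nonzero (A : pmetricType R) (mu : signed_measure A) :
  Zform mu mu != 0 -> nonzero mu.
Proof.
apply: contra_neqP => mu0; rewrite /Zform charge_integral0//.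
  by move=> E mE; apply/eqP/negP => /negP muE; apply: mu0; exists E.
exact: potential_bounded_measurable.
Qed.

(** A point mass has ratio 1, which is what dominates the charges with
    Z(mu, mu) = 0. *)
Lemma point_mass (A : pmetricType R) : exists mu : signed_measure A,
  [/\ finitely_supported mu, positive_measure mu, Zform mu mu = 1
    & mass_ratio mu = 1].
Proof.
pose a : borel A := point.
pose mu : signed_measure A := charge_of_finite_measure (\d_a).
have muE E : measurable E -> mu E = \d_a E by [].
have Z1 : Zform mu mu = 1.
  rewrite /Zform (charge_integral_dirac muE); last first.
    exact: potential_bounded_measurable.
  rewrite (charge_integral_dirac muE); last exact: similarity_bounded_measurable.
  by rewrite /similarity mdistxx oppr0 expR0.
exists mu; split => //.
- exists [set a]; first exact: finite_set1.
  move=> E mE /disjoints_subset Ea; rewrite muE// diracE memNset//.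
  by move=> /Ea; exact.
- by rewrite /mass_ratio Z1 muE// diracT /= expr1n divr1.
Qed.

Lemma positive_nonzero_setT (A : pmetricType R) (mu : signed_measure A) :
  positive_measure mu -> nonzero mu -> mu [set: borel A] != 0%E.
Proof.
move=> mu0 [E mE muE]; apply: contra_neq muE => muT.
have mCE : measurable (~` E) by exact: measurableC.
move: muT; rewrite -(setUv E) chargeU ?setICr//.
by move/eqP; rewrite padde_eq0 ?mu0// => /andP[/eqP].
Qed.

End Zform.

(** * Borel retractions onto finite nets *)

Section finite_net.
Context (R : realType) (A : pmetricType R) (B : {fset A}) (B0 : B != fset0).

Lemma fsval_measurable :
  measurable_fun [set: borel (fsubspace B0)]
    ((fun b : fsubspace B0 => fsval b) : borel (fsubspace B0) -> borel A).
Proof.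
apply: continuous_borel_measurable.
by apply: (@mdist_lipschitz_continuous _ _ _ _ 1) => x y; rewrite mul1r.
Qed.

(** Taking the first close enough point of s, rather than a nearest one, yields
    a nest of tests on open balls, hence a Borel map. The base point is the
    value at the points of A that are far from all of s. *)
Definition first_within (e : R) (s : seq (fsubspace B0)) (x : A) :
    fsubspace B0 :=
  foldr (fun b c : fsubspace B0 => if mdist x (fsval b) < e then b else c)
    (point : fsubspace B0) s.

Lemma first_within_measurable e s :
  measurable_fun [set: borel A]
    (first_within e s : borel A -> borel (fsubspace B0)).
Proof.
elim: s => [|b s IHs] /=; first exact: measurable_cst.
apply: measurable_fun_ifT => //; apply: measurable_fun_ltr => //.
apply: (@lipschitz_borel_measurable _ _ _ 1) => x y; rewrite mul1r.
rewrite ler_norml; apply/andP; split.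
- by have := metric_triangle y x (fsval b); rewrite (metric_sym y x); lra.
- by have := metric_triangle x y (fsval b); lra.
Qed.

Lemma first_within_dist e s x b : b \in s -> mdist x (fsval b) < e ->
  mdist x (fsval (first_within e s x)) < e.
Proof.
elim: s => // c s IHs; rewrite inE /= => /orP[/eqP -> xc|bs xb].
  by case: ifPn => // /negP.
by case: ifPn => // _; exact: IHs.
Qed.

End finite_net.

(** The covering x |-> interior of the ball of radius e at x has a finite
    subcover, whose centres form B. *)
Lemma compact_finite_net (R : realType) (A : pmetricType R) (e : R) :
  compact [set: A] -> 0 < e ->
  exists (B : {fset A}) (B0 : B != fset0) (r : A -> fsubspace B0),
    measurable_fun [set: borel A] (r : borel A -> borel (fsubspace B0)) /\
    forall x, mdist x (fsval (r x)) < e.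
Proof.
move=> cA e0; move: (cA); rewrite compact_cover.
move=> /(_ A [set: A] (fun x => (ball x e)^°)).
case.
- by move=> x _; exact: open_interior.
- by move=> x _; exists x => //; exact: (nbhsx_ballx x e e0).
move=> B _ AB.
have B0 : B != fset0.
  by have [b bB _] := AB point I; apply/fset0Pn; exists b.
exists B, B0, (first_within e (enum {: fsubspace B0})).
split=> [|x]; first exact: first_within_measurable.
have [b bB /interior_subset] := AB x I; rewrite ballEmdist/= => bx.
apply: (@first_within_dist _ _ _ _ _ _ _ [` bB]%fset).
  by rewrite mem_enum.
by rewrite metric_sym.
Qed.

(** * Charges on finite subspaces and charges on A *)

Section approximation.
Context (R : realType).

(** The image of nu under the inclusion, which is isometric. *)
Lemma extend_fsubspace_charge (A : pmetricType R) (B : {fset A})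
    (B0 : B != fset0) (nu : signed_measure (fsubspace B0)) :
  exists mu : signed_measure A,
    [/\ finitely_supported mu, positive_measure nu -> positive_measure mu,
        mu [set: borel A] = nu [set: borel (fsubspace B0)]
      & Zform mu mu = Zform nu nu].
Proof.
have [mu muE] := exists_pushforward nu (@fsval_measurable _ _ _ B0).
exists mu; split.
- exists [set` B] => [|E mE EB]; first exact: finite_fset.
  rewrite muE [X in nu X](_ : _ = set0) ?charge0//.
  rewrite -subset0 => b Eb; have : (E `&` [set` B]) (fsval b).
    by split => //; exact: fsvalP.
  by rewrite EB.
- move=> nu0 E mE; rewrite muE; apply: nu0.
  by rewrite -[X in measurable X]setTI; exact: fsval_measurable.
- by rewrite muE preimage_setT.
- exact: (Zform_isometry (@fsval_measurable _ _ _ B0) muE).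
Qed.

(** The image of mu under a retraction r onto a fine net. As d(x, r x) < s for
    all x, distances change by at most 2 s, so Z moves by at most 2 c s. *)
Lemma approx_by_fsubspace_charge (A : pmetricType R) (mu : signed_measure A)
    (e : R) :
  compact [set: A] -> Zform mu mu != 0 -> 0 < e ->
  exists (B : {fset A}) (B0 : B != fset0) (nu : signed_measure (fsubspace B0)),
    [/\ positive_measure mu -> positive_measure nu,
        nu [set: borel (fsubspace B0)] = mu [set: borel A],
        Zform nu nu != 0
      & mass_ratio mu <= mass_ratio nu + e].
Proof.
move=> cA Z0 e0; pose m := fine (mu [set: borel A]) ^+ 2.
have : m / z @[z --> Zform mu mu] --> m / Zform mu mu.
  by apply: cvgM; [exact: cvg_cst|exact: cvgV].
move=> /cvgrPdist_lt /(_ e e0) /nbhs_ballP[d /= d0 md].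
have [D /= D0 ZD] : \forall z \near Zform mu mu, z != 0.
  by apply: (@open_neq R 0).
have [c c0 muc] := Zform_pushforward_near mu.
(* Within d of Z(mu, mu) the ratio moves by less than e; within D, Z is nonzero.
   The mesh s makes 2 c s smaller than both. *)
pose s := Num.min d D / (4 * (c + 1)).
have s0 : 0 < s by rewrite divr_gt0 ?lt_min ?d0 ?D0// mulr_gt0// ltr_wpDl.
have [B [B0 [r [mr rs]]]] := compact_finite_net cA s0.
have [nu nuE] := exists_pushforward mu mr.
have : `|Zform nu nu - Zform mu mu| <= c * (2 * s).
  apply: (muc _ r) => // x y.
  rewrite (_ : mdist (r x) (r y) = mdist (fsval (r x)) (fsval (r y)))//.
  have := ltW (rs x); have := ltW (rs y).
  have := metric_triangle x (fsval (r x)) y.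
  have := metric_triangle (fsval (r x)) (fsval (r y)) y.
  have := metric_triangle (fsval (r x)) x (fsval (r y)).
  have := metric_triangle x y (fsval (r y)).
  rewrite (metric_sym (fsval (r x)) x) (metric_sym (fsval (r y)) y).
  by move=> *; rewrite ler_norml; apply/andP; split; lra.
have : c * (2 * s) < Num.min d D.
  rewrite /s; set t := Num.min d D.
  have t0 : 0 < t by rewrite lt_min d0.
  rewrite mulrCA -/t mulrA mulrA.
  rewrite ltr_pdivrMr ?mulr_gt0// ?ltr_wpDl//; nra.
move=> /[swap] /le_lt_trans /[apply]; rewrite lt_min distrC => /andP[Zd ZD'].
exists B, B0, nu; split.
- move=> mu0 E mE; rewrite nuE; apply: mu0.
  by rewrite -[X in measurable X]setTI; exact: mr.
- by rewrite nuE preimage_setT.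
- exact: ZD.
- have := md _ Zd; rewrite /= /mass_ratio nuE preimage_setT -/m.
  by move=> /ltr_normlW; lra.
Qed.

End approximation.

(** * Comparing the suprema *)

Lemma cyclic_le_eq d (T : porderType d) (x y z : T) :
  (x <= y -> y <= z -> z <= x -> x = z /\ x = y)%O.
Proof.
move=> xy yz zx; split; apply/le_anti; rewrite ?zx ?xy ?(le_trans xy)//=.
exact: le_trans zx.
Qed.

Section suprema.
Context (R : realType).
Local Open Scope ereal_scope.

Lemma magnitude_ge1 (A : pmetricType R) : 1 <= magnitude A.
Proof.
have [mu [_ _ Z1 <-]] := point_mass A.
apply: ereal_sup_ubound; exists mu => //=.
by rewrite Z1 oner_neq0.
Qed.

Lemma maximum_diversity_ge1 (A : pmetricType R) : 1 <= maximum_diversity A.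
Proof.
have [mu [_ mu0 Z1 <-]] := point_mass A.
apply: ereal_sup_ubound; exists mu => //=.
by split => //; apply: Zform_neq0_nonzero; rewrite Z1 oner_neq0.
Qed.

Context (A : pmetricType R).

Lemma magnitude_le_fsubspaces : compact [set: A] ->
  magnitude A <= ereal_sup [set m | exists (B : {fset A}) (B0 : B != fset0),
                             m = magnitude (fsubspace B0)].
Proof.
move=> cA; apply: ge_ereal_sup => _ [mu /= Z0 <-].
apply/lee_addgt0Pr => e e0.
have [B [B0 [nu [_ _ nuZ]]]] := approx_by_fsubspace_charge cA Z0 e0.
rewrite -lee_fin EFinD => /le_trans; apply; rewrite leeD2r//.
apply: (@le_trans _ _ (magnitude (fsubspace B0))); apply: ereal_sup_ubound.
  by exists nu.
by exists B, B0.
Qed.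

Lemma maximum_diversity_le_fsubspaces : compact [set: A] ->
  maximum_diversity A <=
  ereal_sup [set m | exists (B : {fset A}) (B0 : B != fset0),
               m = maximum_diversity (fsubspace B0)].
Proof.
move=> cA; apply: ge_ereal_sup => _ [mu /= [mu0 mun] <-].
have [Z0|Z0] := eqVneq (Zform mu mu) 0%R.
  (* The ratio is 0 by convention, and a one-point subspace beats it. *)
  rewrite /mass_ratio Z0 invr0 mulr0.
  have B0 : [fset (point : A)]%fset != fset0.
    by apply/fset0Pn; exists point; exact: fset11.
  apply: (le_trans lee01).
  apply: (le_trans (maximum_diversity_ge1 (fsubspace B0))).
  by apply: ereal_sup_ubound; exists [fset (point : A)]%fset, B0.
apply/lee_addgt0Pr => e e0.
have [B [B0 [nu [nu0 nuT _]]]] := approx_by_fsubspace_charge cA Z0 e0.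
rewrite -lee_fin EFinD => /le_trans; apply; rewrite leeD2r//.
apply: (@le_trans _ _ (maximum_diversity (fsubspace B0))); last first.
  by apply: ereal_sup_ubound; exists B, B0.
apply: ereal_sup_ubound; exists nu => //=; split; first exact: nu0.
by exists setT => //; rewrite nuT; exact: positive_nonzero_setT.
Qed.

Lemma magnitude_fsubspace_le (B : {fset A}) (B0 : B != fset0) :
  magnitude (fsubspace B0) <= ereal_sup [set (mass_ratio mu)%:E
                  | mu in [set mu : signed_measure A |
                            finitely_supported mu /\ nonzero mu]].
Proof.
apply: ge_ereal_sup => _ [nu /= Z0 <-].
have [mu [muF _ muT muZ]] := extend_fsubspace_charge nu.
apply: ereal_sup_ubound; exists mu => /=; last by rewrite /mass_ratio muT muZ.
by split => //; apply: Zform_neq0_nonzero; rewrite muZ.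
Qed.

Lemma maximum_diversity_fsubspace_le (B : {fset A}) (B0 : B != fset0) :
  maximum_diversity (fsubspace B0) <= ereal_sup [set (mass_ratio mu)%:E
                  | mu in [set mu : signed_measure A |
                            [/\ finitely_supported mu, positive_measure mu
                              & nonzero mu]]].
Proof.
apply: ge_ereal_sup => _ [nu /= [nu0 nun] <-].
have [mu [muF mu0 muT muZ]] := extend_fsubspace_charge nu.
apply: ereal_sup_ubound; exists mu => /=; last by rewrite /mass_ratio muT muZ.
split => //; first exact: mu0.
by exists setT => //; rewrite muT; exact: positive_nonzero_setT.
Qed.

Lemma mass_ratio_le_magnitude (mu : signed_measure A) :
  (mass_ratio mu)%:E <= magnitude A.
Proof.
have [Z0|Z0] := eqVneq (Zform mu mu) 0%R; last first.
  by apply: ereal_sup_ubound; exists mu.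
by rewrite /mass_ratio Z0 invr0 mulr0 (le_trans lee01)// magnitude_ge1.
Qed.

End suprema.

Theorem theorem2p4 (R : realType) (A : pmetricType R)
    (cA : compact [set: A]) (pdA : positive_definite A) :
  [/\ magnitude A =
        ereal_sup [set (mass_ratio mu)%:E
                  | mu in [set mu : signed_measure A |
                            finitely_supported mu /\ nonzero mu]],
      magnitude A =
        ereal_sup [set m | exists (B : {fset A}) (B0 : B != fset0),
                             m = magnitude (fsubspace B0)],
      maximum_diversity A =
        ereal_sup [set (mass_ratio mu)%:E
                  | mu in [set mu : signed_measure A |
                            [/\ finitely_supported mu, positive_measure mu
                              & nonzero mu]]]
    & maximum_diversity A =
        ereal_sup [set m | exists (B : {fset A}) (B0 : B != fset0),
                             m = maximum_diversity (fsubspace B0)]].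
Proof.
have B_FM : (ereal_sup [set m | exists (B : {fset A}) (B0 : B != fset0),
      m = magnitude (fsubspace B0)] <= ereal_sup [set (mass_ratio mu)%:E
      | mu in [set mu : signed_measure A |
                finitely_supported mu /\ nonzero mu]])%E.
  by apply: ge_ereal_sup => _ [B [B0 ->]]; exact: magnitude_fsubspace_le.
have [|mFM mB] := cyclic_le_eq (magnitude_le_fsubspaces cA) B_FM.
  by apply: ge_ereal_sup => _ [mu _ <-]; exact: mass_ratio_le_magnitude.
have BD_FM : (ereal_sup [set m | exists (B : {fset A}) (B0 : B != fset0),
      m = maximum_diversity (fsubspace B0)] <= ereal_sup [set (mass_ratio mu)%:E
      | mu in [set mu : signed_measure A |
                [/\ finitely_supported mu, positive_measure mu & nonzero mu]]])%E.
  apply: ge_ereal_sup => _ [B [B0 ->]].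
  exact: maximum_diversity_fsubspace_le.
have [|dFM dB] := cyclic_le_eq (maximum_diversity_le_fsubspaces cA) BD_FM.
  apply: ereal_sup_le => _ [mu [_ mu0 mun] <-].
  by exists mu.
by split.
Qed.
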